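(* Let $D\ge 2$, $N\ge 1$, $M\ge 0$ be integers, let $P=(p_0,\ldots,p_{N-1})\in\{0,\ldots,D-1\}^N$ be a fixed schedule, and let $\mathcal S=\mathcal N(\mathbf A(P))\subseteq\mathbb C^N$ be the null space of the constraint matrix $\mathbf A(P)$ of null order $M$. Let $\mathbf P_{\mathcal S}$ denote the orthogonal projector of $\mathbb C^N$ onto $\mathcal S$, and let $\mathbf 1_N\in\mathbb C^N$ be the all-ones vector. Provided that $\mathbf P_{\mathcal S}\mathbf 1_N\neq\mathbf 0$, the vector $$\mathbf q^\star(P)=\frac{\mathbf P_{\mathcal S}\mathbf 1_N}{\|\mathbf P_{\mathcal S}\mathbf 1_N\|_2}$$ is a unit-norm maximizer of the problem $$\max_{\mathbf q\in\mathcal S,\ \mathbf q\neq\mathbf 0}\ \frac{|\mathbf 1_N^T\mathbf q|^2}{\|\mathbf q\|_2^2},$$ and the corresponding maximum of the output SNR $\rho(\mathbf q)$ over nonzero $\mathbf q\in\mathcal S$ is $$\rho_{\max}(P)=\frac{L\sigma_b^2}{N_0}\,\|\mathbf P_{\mathcal S}\mathbf 1_N\|_2^2 .$$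
   Context: Let $\omega=e^{j2\pi/D}$, where $j$ is the imaginary unit. The moment matrix $\mathbf V$ is the $(M+1)\times N$ real matrix with entries $[\mathbf V]_{m,n}=n^m$ for $m=0,\ldots,M$, $n=0,\ldots,N-1$ (with $0^0=1$). For $r=1,\ldots,D-1$, $\mathbf D_r(P)=\operatorname{diag}(\omega^{rp_0},\omega^{rp_1},\ldots,\omega^{rp_{N-1}})$. The constraint matrix $\mathbf A(P)\in\mathbb C^{(D-1)(M+1)\times N}$ is obtained by vertically stacking the blocks $\mathbf V\mathbf D_1(P),\ldots,\mathbf V\mathbf D_{D-1}(P)$. The output SNR of a nonzero weight vector $\mathbf q\in\mathbb C^N$ is $$\rho(\mathbf q)=\frac{L\sigma_b^2}{N_0}\,\frac{|\mathbf 1_N^T\mathbf q|^2}{\|\mathbf q\|_2^2},$$ where $L\ge1$ is an integer (code length) and $\sigma_b^2>0$, $N_0>0$ are fixed constants (target power and noise power). *)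

(* Defs.v *)
From HB Require Import structures.
From mathcomp Require Import all_boot all_order all_algebra.
From mathcomp Require Import complex.
From mathcomp Require Import classical_sets reals trigo.

Set Implicit Arguments.
Unset Strict Implicit.
Unset Printing Implicit Defensive.

Import Order.TTheory GRing.Theory Num.Theory.
Local Open Scope ring_scope.
Local Open Scope complex_scope.
Local Open Scope sesquilinear_scope.

(* e^{j 2 pi / D}, by Euler's formula. *)
Definition omega (R : realType) (D : nat) : R[i] :=
  cos (2 * pi / D%:R) +i* sin (2 * pi / D%:R).

(* 0 ^+ 0 = 1 in the top-left corner. *)
Definition moment_mx (R : realType) (M N : nat) : 'M[R]_(M.+1, N) :=
  \matrix_(m < M.+1, n < N) (n%:R ^+ m).

Definition phase_mx (R : realType) (D N : nat) (p : N.-tuple 'I_D) (r : nat) :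
    'M[R[i]]_N :=
  diag_mx (\row_(n < N) omega R D ^+ (r * tnth p n)).

(* The ordinal r : 'I_D.-1 stands for the block index r.+1 in {1, ..., D-1}. *)
Definition constraint_mx (R : realType) (M D N : nat) (p : N.-tuple 'I_D) :
    'M[R[i]]_(\sum_(r < D.-1) M.+1, N) :=
  \mxcol_(r < D.-1) (map_mx (real_complex R) (moment_mx R M N)
                     *m phase_mx R p r.+1).

Definition nullspace (C : numClosedFieldType) (m n : nat) (A : 'M[C]_(m, n)) :
    set 'cV[C]_n :=
  [set q | A *m q = 0].

(* The library's subspaces are row spaces and its projectors act on row vectors
   from the right, hence the transpositions: the rows of kermx A^T span the
   transposes of the elements of nullspace A. See null_projP below. *)
Definition null_proj (C : numClosedFieldType) (m n : nat) (A : 'M[C]_(m, n)) :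
    'M[C]_n :=
  (proj_ortho (kermx A^T))^T.

Lemma null_projP (C : numClosedFieldType) (m n : nat) (A : 'M[C]_(m, n))
    (x : 'cV[C]_n) :
  nullspace A (null_proj A *m x) /\
  forall y, nullspace A y -> y^t* *m (x - null_proj A *m x) = 0.
Proof.
have memE (z : 'cV[C]_n) : (z^T <= kermx A^T)%MS <-> nullspace A z.
  rewrite (sameP sub_kermxP eqP) -trmx_mul -(inj_eq trmx_inj) trmxK trmx0.
  by split => [/eqP|h]; last by apply/eqP.
split; first by apply/memE; rewrite trmx_mul trmxK proj_ortho_sub.
move=> y /memE /submxP[w yE].
have := proj_ortho_compl_sub (kermx A^T) x^T; rewrite orthomx1E => /eqP perp.
apply: trmx_inj; rewrite trmx_mul linearB /= trmx_mul trmxK trmx0.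
have -> : (y^t*)^T = (y^T)^t* by rewrite trmxK map_trmx trmxK.
by rewrite yE trmx_mul map_mxM mulmxA perp mul0mx.
Qed.

Definition norm2 (R : realType) (n : nat) (q : 'cV[R[i]]_n) : R :=
  Num.sqrt (\sum_(i < n) ComplexField.Normc.normc (q i 0) ^+ 2).

(* |1_N^T q|^2 / ||q||_2^2; only meaningful for q != 0. *)
Definition coherent_gain (R : realType) (n : nat) (q : 'cV[R[i]]_n) : R :=
  ComplexField.Normc.normc (((const_mx 1 : 'cV[R[i]]_n)^T *m q) 0 0) ^+ 2
  / norm2 q ^+ 2.

Definition output_snr (R : realType) (L : nat) (sigma_b N0 : R) (n : nat)
    (q : 'cV[R[i]]_n) : R :=
  L%:R * sigma_b ^+ 2 / N0 * coherent_gain q.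

Definition is_maximizer (R : realType) (T : Type) (X : set T) (f : T -> R)
    (x : T) : Prop :=
  X x /\ forall y, X y -> f y <= f x.

Definition is_maximum (R : realType) (T : Type) (X : set T) (f : T -> R)
    (v : R) : Prop :=
  exists2 x, is_maximizer X f x & f x = v.

(* Main.v *)
Require Import Defs.
From mathcomp Require Import all_boot all_order all_algebra.
From mathcomp Require Import complex.
From mathcomp Require Import classical_sets reals trigo.

Set Implicit Arguments.
Unset Strict Implicit.
Unset Printing Implicit Defensive.

Import Order.TTheory GRing.Theory Num.Theory.
Local Open Scope ring_scope.
Local Open Scope complex_scope.
Local Open Scope classical_set_scope.
Local Open Scope sesquilinear_scope.
Import ComplexField.Normc.

(** For [q] in [S], [1^T q] is conjugate to [<q, P_S 1>], so Cauchy-Schwarz bounds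
    the coherent gain by [||P_S 1||^2]; [q = P_S 1] attains the bound, and the gain
    is invariant under scaling. *)

Section Norm2.
Variables (R : realType) (n : nat).
Implicit Types (q u v : 'cV[R[i]]_n) (c : R).

Lemma normcC (z : R[i]) : (normc z)%:C = `|z|.
Proof. by case: z. Qed.

Lemma norm2_sqr q : norm2 q ^+ 2 = \sum_(i < n) normc (q i 0) ^+ 2.
Proof. by rewrite sqr_sqrtr // sumr_ge0 // => i _; rewrite sqr_ge0. Qed.

Lemma norm2_sqrC q : (norm2 q ^+ 2)%:C = (q^t* *m q) 0 0.
Proof.
rewrite norm2_sqr rmorph_sum mxE; apply: eq_bigr => i _.
by rewrite !mxE rmorphXn /= normcC normCKC.
Qed.

(** The form [dotmx] takes row vectors and conjugates its second argument, hence the transposes and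
    the swapped order of [u] and [v]. *)
Lemma dotmx_trE u v : dotmx u^T v^T = (v^t* *m u) 0 0.
Proof.
by rewrite dotmxE !mxE; apply: eq_bigr => i _; rewrite !mxE mulrC.
Qed.

Lemma cauchy_schwarz_norm2 u v :
  normc ((u^t* *m v) 0 0) ^+ 2 <= norm2 u ^+ 2 * norm2 v ^+ 2.
Proof.
(* Embedding the real inequality into [R[i]] turns both sides into expressions in the Hermitian form
   [dotmx]; [mulrC] matches the swap made by [dotmx_trE]. *)
rewrite -lecR rmorphXn rmorphM /= normcC !norm2_sqrC -!dotmx_trE mulrC.
exact: (CauchySchwarz (@dotmx _ n)).
Qed.

Lemma norm2_gt0 q : q <> 0 -> 0 < norm2 q.
Proof.
move=> /eqP q0; rewrite lt_neqAle sqrtr_ge0 andbT eq_sym -sqrf_eq0.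
(* In [R[i]] the squared norm is [dotmx q^T q^T], and this form is definite. *)
rewrite -(inj_eq (@complexI R)) norm2_sqrC -dotmx_trE.
by rewrite (dnorm_eq0 (@dotmx _ n)) trmx_eq0.
Qed.

Lemma norm2Z c q : norm2 (c%:C *: q) = `|c| * norm2 q.
Proof.
rewrite /norm2 -sqrtr_sqr -sqrtrM ?sqr_ge0 // mulr_sumr; congr Num.sqrt.
apply: eq_bigr => i _; rewrite mxE normcM exprMn.
(* The modulus of the real scalar [c%:C] computes to the square root of [c ^+ 2 + 0 ^+ 2]. *)
by rewrite /= expr0n addr0 sqr_sqrtr ?sqr_ge0.
Qed.

Lemma coherent_gainZ c q : c != 0 -> coherent_gain (c%:C *: q) = coherent_gain q.
Proof.
move=> c0; rewrite /coherent_gain norm2Z -scalemxAr mxE.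
rewrite normcM /= expr0n addr0 sqrtr_sqr !exprMn invfM.
by rewrite mulrACA divff ?mul1r // sqrf_eq0 normr_eq0.
Qed.

End Norm2.

Section NullProj.
Variables (R : realType) (m n : nat) (A : 'M[R[i]]_(m, n)).
Let P1 := null_proj A *m (const_mx 1 : 'cV[R[i]]_n).

Lemma nullspaceZ (a : R[i]) (q : 'cV[R[i]]_n) :
  nullspace A q -> nullspace A (a *: q).
Proof. by rewrite /nullspace /= -scalemxAr => ->; rewrite scaler0. Qed.

(** The residual of the all-ones vector after projection is orthogonal to [q], so [P1] may be
    replaced by that vector in [q^t* *m P1]; the result is the conjugate of [1^T q], of equal
    modulus. *)
Lemma normc_sum_null_proj (q : 'cV[R[i]]_n) : nullspace A q ->
  normc (((const_mx 1 : 'cV[R[i]]_n)^T *m q) 0 0) = normc ((q^t* *m P1) 0 0).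
Proof.
move=> /(null_projP A (const_mx 1)).2; rewrite mulmxBr => /eqP.
rewrite subr_eq0 => /eqP <-; apply: (@complexI R); rewrite !normcC.
rewrite -norm_conjC !mxE rmorph_sum; congr `|_|; apply: eq_bigr => i _.
by rewrite !mxE mul1r mulr1.
Qed.

Lemma coherent_gain_le (q : 'cV[R[i]]_n) : nullspace A q -> q <> 0 ->
  coherent_gain q <= norm2 P1 ^+ 2.
Proof.
move=> Aq q0; rewrite /coherent_gain normc_sum_null_proj //.
by rewrite ler_pdivrMr ?exprn_gt0 ?norm2_gt0 // mulrC cauchy_schwarz_norm2.
Qed.

Lemma coherent_gain_null_proj : P1 <> 0 -> coherent_gain P1 = norm2 P1 ^+ 2.
Proof.
move=> P10; rewrite /coherent_gain normc_sum_null_proj; last first.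
  exact: (null_projP A _).1.
(* With [q = P1] the inner product is the real number [norm2 P1 ^+ 2], so the gain is its square
   divided by itself. *)
rewrite -norm2_sqrC /= expr0n addr0 sqrtr_sqr real_normK ?num_real //.
by rewrite expr2 mulfK // sqrf_eq0 gt_eqF ?norm2_gt0.
Qed.

End NullProj.

Theorem mainTheorem1 (R : realType) (D N M : nat)
    (hD : (2 <= D)%N) (hN : (1 <= N)%N) (p : N.-tuple 'I_D)
    (L : nat) (hL : (1 <= L)%N)
    (sigma_b N0 : R) (hsigma : 0 < sigma_b ^+ 2) (hN0 : 0 < N0) :
  let A := constraint_mx R M p in
  let S := nullspace A in
  let S_nonzero := [set q | S q /\ q <> 0] in
  let P1 := null_proj A *m (const_mx 1 : 'cV[R[i]]_N) in
  let qstar := ((norm2 P1)^-1)%:C *: P1 in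
  P1 <> 0 ->
  [/\ norm2 qstar = 1,
      is_maximizer S_nonzero (@coherent_gain R N) qstar &
      is_maximum S_nonzero (@output_snr R L sigma_b N0 N)
        (L%:R * sigma_b ^+ 2 / N0 * norm2 P1 ^+ 2)].
Proof.
move=> A S S_nonzero P1 qstar P10.
have n_gt0 : 0 < norm2 P1 by exact: norm2_gt0.
have gainE : coherent_gain qstar = norm2 P1 ^+ 2.
  by rewrite coherent_gainZ ?invr_neq0 ?gt_eqF // coherent_gain_null_proj.
have qstar_max : is_maximizer S_nonzero (@coherent_gain R N) qstar.
  split=> [|q [Sq q0]]; last by rewrite gainE coherent_gain_le.
  split; first by apply: nullspaceZ; exact: (null_projP A _).1.
  apply/eqP; rewrite scaler_eq0 negb_or; apply/andP; split; last exact/eqP.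
  by rewrite (inj_eq (@complexI R) _ 0) invr_eq0 gt_eqF.
split=> //; first by rewrite norm2Z gtr0_norm ?invr_gt0 // mulVf ?gt_eqF.
(* The SNR is the gain times a nonnegative constant, so the maximizer of the gain also serves
   here. *)
exists qstar; last by rewrite /output_snr gainE.
case: qstar_max => Sqstar le_qstar; split=> // q Sq.
by rewrite ler_wpM2l ?le_qstar // divr_ge0 ?(ltW hN0) // mulr_ge0 ?ler0n ?ltW.
Qed.
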